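(* Let $(X,T)$ and $(Y,S)$ be topological dynamical systems, let $\pi:(X,T)\to(Y,S)$ be a factor map, and let $\mathrm{scl}=\{\mathrm{scl}_\alpha\}_{\alpha\ge0}$ be a scaling. Then: (1) For every non-empty compact set $K\subset X$, $$\overline h^{C}_{\mathrm{scl}}(S,\pi(K))\le\overline h^{C}_{\mathrm{scl}}(T,K)\le\Gamma_{\mathrm{scl}}\bigl(\overline h^{C}_{\mathrm{scl}}(S,\pi(K)),a_\pi\bigr).$$ (2) For every non-empty subset $E\subset X$, $$h^{B}_{\mathrm{scl}}(S,\pi(E))\le h^{B}_{\mathrm{scl}}(T,E)\le\Gamma_{\mathrm{scl}}\bigl(h^{B}_{\mathrm{scl}}(S,\pi(E)),a_\pi\bigr).$$
   Context: A topological dynamical system $(X,T)$ consists of a compact metric space $(X,d)$ and a continuous map $T:X\to X$. A factor map $\pi:(X,T)\to(Y,S)$ is a continuous surjection with $\pi\circ T=S\circ\pi$. $\mathbb N=\{1,2,\dots\}$. Put $d_n(x,y)=\max_{0\le j<n}d(T^jx,T^jy)$ and $B_n(x,\epsilon)=\{y: d_n(x,y)<\epsilon\}$. A scaling is a family $\mathrm{scl}=(\mathrm{scl}_\alpha)_{\alpha\ge0}$ of positive non-decreasing functions on $(0,1)$ such that for all $\alpha>\beta>0$ and every $\lambda>1$ sufficiently close to $1$, $\mathrm{scl}_\alpha(\epsilon)=o(\mathrm{scl}_\beta(\epsilon^\lambda))$ and $\mathrm{scl}_\alpha(\epsilon)=o(\mathrm{scl}_\beta(\epsilon)^\lambda)$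 as $\epsilon\to0^+$. Standing assumption: $\lim_{\epsilon\to0}\mathrm{scl}_\alpha(\epsilon)=0$ for every $\alpha>0$. For $A\subset X$ non-empty, $r_n(A,\epsilon)$ is the minimal cardinality of a set $E\subset X$ with $A\subset\bigcup_{x\in E}B_n(x,\epsilon)$, and $s_n(A,\epsilon)$ is the maximal cardinality of a set $F\subset A$ with $d_n(x,y)\ge\epsilon$ for all distinct $x,y\in F$. Upper capacity entropy scale: for $K$ non-empty compact, $\overline\Lambda_{\mathrm{scl}_\alpha}(T,K)=\lim_{\epsilon\to0}\limsup_{n\to\infty}s_n(K,\epsilon)\,\mathrm{scl}_\alpha(e^{-n})$ and $\overline h^C_{\mathrm{scl}}(T,K)=\inf\{\alpha>0:\overline\Lambda_{\mathrm{scl}_\alpha}(T,K)=0\}=\sup\{\alpha>0:\overline\Lambda_{\mathrm{scl}_\alpha}(T,K)=\infty\}$ (the two agree; $\sup\emptyset=0$, $\inf\emptyset=+\infty$). Bowen entropy scale: for non-empty $E$, $M_{\mathrm{scl}_\alpha}(T,E,\epsilon,N)=\inf\sum_{i}\mathrm{scl}_\alpha(e^{-n_i})$, the infimum over finite or countable covers $\{B_{n_i}(x_i,\epsilon)\}_i$ of $E$ with $n_i\ge N$, $x_i\in X$; $M_{\mathrm{scl}_\alpha}(T,E)=\lim_{\epsilon\to0}\lim_{N\to\infty}M_{\mathrm{scl}_\alpha}(T,E,\epsilon,N)$; $h^B_{\mathrm{scl}}(T,E)=\sup\{\alpha>0:M_{\mathrm{scl}_\alpha}(T,E)=\infty\}=\inf\{\alpha>0:M_{\mathrm{scl}_\alpha}(T,E)=0\}$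 (same conventions). Fiber entropy: $h^U_{\mathrm{top}}(T,A)=\lim_{\epsilon\to0}\limsup_{n\to\infty}\frac1n\log r_n(A,\epsilon)$ and $a_\pi=\sup_{y\in Y}h^U_{\mathrm{top}}(T,\pi^{-1}(y))$. Transfer function: for $u,a\in[0,+\infty)$, $$\Gamma_{\mathrm{scl}}(u,a)=\inf\Bigl\{\gamma>0:\ \exists\,\alpha>u,\ \tau>0\text{ such that }\limsup_{n\to\infty}e^{(a+\tau)n}\frac{\mathrm{scl}_\gamma(e^{-n})}{\mathrm{scl}_\alpha(e^{-n})}<+\infty\Bigr\},$$ with $\inf\emptyset=+\infty$, and $\Gamma_{\mathrm{scl}}(u,a)=+\infty$ if $u=+\infty$ or $a=+\infty$. *)

(* Defs.v *)
From HB Require Import structures.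
From mathcomp Require Import all_boot all_order all_algebra finmap.
From mathcomp Require Import all_classical all_reals all_analysis.

Set Implicit Arguments.
Unset Strict Implicit.
Unset Printing Implicit Defensive.

Import Order.TTheory GRing.Theory Num.Theory.
Import numFieldNormedType.Exports.

Local Open Scope classical_set_scope.
Local Open Scope ring_scope.

Section dynamics.
Context {R : realType}.

Definition dynamical_system (X : metricType R) (T : X -> X) : Prop :=
  compact [set: X] /\ continuous T.

Definition factor_map (X Y : metricType R) (T : X -> X) (S : Y -> Y)
    (pi : X -> Y) : Prop :=
  [/\ continuous pi, set_surj [set: X] [set: Y] pi & pi \o T =1 S \o pi].

Definition bowen_dist (X : metricType R) (T : X -> X) (n : nat) (x y : X) : R :=
  \big[Num.max/0]_(j < n) mdist (iter j T x) (iter j T y).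

Definition bowen_ball (X : metricType R) (T : X -> X) (n : nat) (x : X)
    (eps : R) : set X :=
  [set y | bowen_dist T n x y < eps].

Definition spanning_number (X : metricType R) (T : X -> X) (A : set X)
    (n : nat) (eps : R) : \bar R :=
  ereal_inf [set (#|` E|%fset)%:R%:E | E in
    [set E : {fset X} | A `<=` \bigcup_(x in [set` E]) bowen_ball T n x eps]].

Definition separated_number (X : metricType R) (T : X -> X) (A : set X)
    (n : nat) (eps : R) : \bar R :=
  ereal_sup [set (#|` F|%fset)%:R%:E | F in
    [set F : {fset X} | [set` F] `<=` A /\
      forall x y, x \in F -> y \in F -> x != y -> eps <= bowen_dist T n x y]].

Local Notation near0 := (0%R : R)^'+.

(* A family indexed by [0, +oo[ of functions on ]0, 1[; values of [scl a e]
   outside these ranges are unconstrained and never matter below. *)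
Definition scaling (scl : R -> R -> R) : Prop :=
  [/\ (forall a e : R, 0 <= a -> 0 < e < 1 -> 0 < scl a e),
      (forall a e e' : R, 0 <= a -> 0 < e -> e <= e' -> e' < 1 ->
         scl a e <= scl a e'),
      (forall a b : R, 0 < b -> b < a -> \forall l \near 1^'+,
         (scl a : R -> R^o) =o_near0 (fun e => scl b (e `^ l) : R^o) /\
         (scl a : R -> R^o) =o_near0 (fun e => scl b e `^ l : R^o)) &
      (forall a : R, 0 < a -> scl a e @[e --> 0^'+] --> 0)].

Definition scl_exp (scl : R -> R -> R) (a : R) (n : nat) : R :=
  scl a (expR (- n%:R)).

Local Open Scope ereal_scope.

Definition upper_capacity (scl : R -> R -> R) (a : R) (X : metricType R)
    (T : X -> X) (K : set X) : \bar R :=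
  lim (limn_esup (fun n =>
    separated_number T K n eps * (scl_exp scl a n)%:E) @[eps --> 0%R^'+]).

Definition upper_capacity_entropy (scl : R -> R -> R) (X : metricType R)
    (T : X -> X) (K : set X) : \bar R :=
  ereal_inf [set a%:E | a in
    [set a : R | (0 < a)%R /\ upper_capacity scl a T K = 0]].

Definition bowen_premeasure (scl : R -> R -> R) (a : R) (X : metricType R)
    (T : X -> X) (E : set X) (eps : R) (N : nat) : \bar R :=
  ereal_inf [set s | exists (I : set nat) (x : nat -> X) (n : nat -> nat),
    [/\ (forall i, I i -> (0 < n i)%N /\ (N <= n i)%N),
        E `<=` \bigcup_(i in I) bowen_ball T (n i) (x i) eps &
        s = \esum_(i in I) (scl_exp scl a (n i))%:E]].

Definition bowen_measure (scl : R -> R -> R) (a : R) (X : metricType R)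
    (T : X -> X) (E : set X) : \bar R :=
  lim (limn (bowen_premeasure scl a T E eps) @[eps --> 0%R^'+]).

(* [0] is adjoined so that the supremum is 0 when no [a] qualifies. *)
Definition bowen_entropy (scl : R -> R -> R) (X : metricType R)
    (T : X -> X) (E : set X) : \bar R :=
  ereal_sup (0 |` [set a%:E | a in
    [set a : R | (0 < a)%R /\ bowen_measure scl a T E = +oo]]).

Definition top_entropy (X : metricType R) (T : X -> X) (A : set X) : \bar R :=
  lim (limn_esup (fun n =>
    (n%:R^-1)%:E * lne (spanning_number T A n eps)) @[eps --> 0%R^'+]).

Definition fiber_entropy (X Y : metricType R) (T : X -> X) (pi : X -> Y) :
    \bar R :=
  ereal_sup [set top_entropy T (pi @^-1` [set y]) | y in [set: Y]].

Definition transfer (scl : R -> R -> R) (u a : \bar R) : \bar R :=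
  match u, a with
  | u%:E, a%:E => ereal_inf [set g%:E | g in
      [set g : R | (0 < g)%R /\ exists al tau : R,
        [/\ (u < al)%R, (0 < tau)%R &
            limn_esup (fun n => (expR ((a + tau) * n%:R) *
              (scl_exp scl g n / scl_exp scl al n))%:E) < +oo]]]
  | _, _ => +oo
  end.

End dynamics.

(* Main.v *)
Require Import Defs.
From mathcomp Require Import all_boot all_order all_algebra finmap.
From mathcomp Require Import all_classical all_reals all_analysis.
From mathcomp Require Import zify ring lra.

(** The lower bounds follow from the uniform continuity of [pi]: a small Bowen
    ball upstairs is mapped into a Bowen ball downstairs.  For the upper bounds,
    fix [c > a_pi].  Bowen's block argument (finitely many fibers are each
    spanned at some time [m] by at most [exp(cm)] points, and any orbit segment
    downstairs is cut into blocks of these lengths) shows that the preimage of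
    [B_n(y, d)] splits into at most [exp(c(n + M))] pieces of [d_n]-diameter
    less than [e], with [M] and [d] independent of [n] and [y].  Hence both
    separated sets and Bowen covers upstairs are controlled by those downstairs
    up to the factor [exp(c(n + M))], which the definition of the transfer
    function absorbs into the passage from [scl_alpha] to [scl_gamma]. *)

Set Implicit Arguments.
Unset Strict Implicit.
Unset Printing Implicit Defensive.

Import Order.TTheory GRing.Theory Num.Theory.
Import numFieldNormedType.Exports.

Local Open Scope classical_set_scope.
Local Open Scope ring_scope.

(** * Upper limits and one-sided limits in the extended reals *)

Section ereal_limits.
Context {R : realType}.
Local Open Scope ereal_scope.

(** [limn_esup] is an infimum, over the eventual sets [V], of suprema over [V]; a strict upper bound
    is therefore attained on one such [V]. *)
Lemma limn_esup_lt_near (u : nat -> \bar R) c :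
  limn_esup u < c -> \forall n \near \oo, u n < c.
Proof.
move=> /ereal_inf_lt[_ [V oV <-] Vc]; apply: filterS oV => n Vn.
by apply: le_lt_trans Vc; apply: ereal_sup_ubound; exists n.
Qed.

Lemma near_limn_esup_le (u : nat -> \bar R) c :
  (\forall n \near \oo, u n <= c) -> limn_esup u <= c.
Proof.
move=> uc; apply: ge_ereal_inf; eexists; first by exists [set n | u n <= c].
by apply: ge_ereal_sup => _ [n /= unc <-].
Qed.

Lemma near_limn_esup_ge (u : nat -> \bar R) c :
  (\forall n \near \oo, c <= u n) -> c <= limn_esup u.
Proof.
move=> uc; apply: le_ereal_inf_tmp => _ [V oV <-].
have /filter_ex[n [cun Vn]] : \oo ([set n | c <= u n] `&` V) by exact: filterI.
by apply: le_ereal_sup_tmp; exists (u n) => //; exists n.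
Qed.

Lemma le_limn_esup (u v : nat -> \bar R) :
  (\forall n \near \oo, u n <= v n) -> limn_esup u <= limn_esup v.
Proof.
move=> uv; apply: le_ereal_inf_tmp => _ [V oV <-]; apply: near_limn_esup_le.
near=> n; apply: (@le_trans _ _ (v n)); first by near: n.
by apply: ereal_sup_ubound; exists n => //; near: n.
Unshelve. all: by end_near. Qed.

(** Every limit in [eps] in the definitions is taken of a quantity that grows as [eps] decreases.
    Writing it as a supremum settles its existence and reduces estimates to a fixed [eps]. *)
Lemma lim_at_right0 (f : R -> \bar R) :
  {homo f : x y / (x <= y)%R >-> y <= x} ->
  lim (f x @[x --> 0%R^'+]) = ereal_sup (f @` [set x | (0 < x)%R]).
Proof.
move=> nif; apply: cvg_lim => //.
have -> : [set x : R | (0 < x)%R] = [set` Interval (BRight (0%R : R)) +oo%O].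
  by apply/seteqP; split=> x /=; rewrite in_itv /= andbT.
by apply: nonincreasing_at_right_cvge => // x y _ _; exact: nif.
Qed.

End ereal_limits.

(** * Maximal separated subsets of a finite sequence *)

Section greedy.
Variables (U : eqType) (close : rel U).
Hypotheses (closexx : reflexive close) (closeC : symmetric close).

(* Working inside a finite set avoids showing that separated numbers are finite. *)
Lemma maximal_separated (s : seq U) : exists G : seq U,
  [/\ uniq G, {subset G <= s},
      {in G &, forall x y, x != y -> ~~ close x y} &
      forall x, x \in s -> exists2 y, y \in G & close y x].
Proof.
elim: s => [|x s [G [uG Gs sepG sG]]]; first by exists [::].
have [/hasP[y yG yx]|/hasPn Gx] := boolP (has (close^~ x) G).
  exists G; split=> //.
    by move=> z /Gs; rewrite inE orbC => ->.
  by move=> z; rewrite inE => /predU1P[->|/sG//]; exists y.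
exists (x :: G); split.
- by rewrite /= uG andbT; apply/negP => /Gx; rewrite closexx.
- by move=> z; rewrite !inE => /predU1P[->|/Gs ->]; rewrite ?eqxx ?orbT.
- move=> y z; rewrite !inE => /predU1P[->|yG] /predU1P[->|zG] yz.
  + by rewrite eqxx in yz.
  + by rewrite closeC Gx.
  + by rewrite Gx.
  + exact: sepG.
- move=> z; rewrite inE => /predU1P[->|/sG[y yG yz]].
    by exists x; rewrite ?mem_head.
  by exists y => //; rewrite inE yG orbT.
Qed.

End greedy.

(** * Bowen metrics, Bowen balls and spanning numbers *)

Section bowen_metric.
Context {R : realType}.
Variables (X : metricType R) (T : X -> X).
Implicit Types (x y z : X) (e d : R) (m n : nat).

(** Positivity of [e] absorbs the base value 0 of the maximum, so the equivalence also covers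
    [n = 0]. *)
Lemma bowen_dist_ltP n x y e : 0 < e ->
  bowen_dist T n x y < e <->
  forall j, (j < n)%N -> mdist (iter j T x) (iter j T y) < e.
Proof.
move=> e0; split=> [/bigmax_ltP[_ h] j jn|h].
  exact: (h (Ordinal jn)).
by apply/bigmax_ltP; split=> // i _; exact: h.
Qed.

Lemma bowen_dist_ge0 n x y : 0 <= bowen_dist T n x y.
Proof. exact: bigmax_ge_id. Qed.

Lemma bowen_distxx n x : bowen_dist T n x x = 0.
Proof.
apply/eqP; rewrite eq_le bowen_dist_ge0 andbT.
by apply/bigmax_leP; split=> // i _; rewrite mdistxx.
Qed.

Lemma bowen_distC n x y : bowen_dist T n x y = bowen_dist T n y x.
Proof. by apply: eq_bigr => i _; rewrite metric_sym. Qed.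

Lemma bowen_dist_triangle n x y z d e : 0 < d -> 0 < e ->
  bowen_dist T n x y < d -> bowen_dist T n y z < e ->
  bowen_dist T n x z < d + e.
Proof.
move=> d0 e0 /bowen_dist_ltP-/(_ d0) xy /bowen_dist_ltP-/(_ e0) yz.
apply/bowen_dist_ltP; first exact: addr_gt0.
move=> j jn; apply: le_lt_trans (metric_triangle _ (iter j T y) _) _.
by apply: ltrD; [exact: xy|exact: yz].
Qed.

Lemma bowen_ball_open n x e : 0 < e -> continuous T -> open (bowen_ball T n x e).
Proof.
move=> e0 cT; rewrite openE => y /= xy.
have citer j : continuous (iter j T).
  elim: j => [|j IH] z; first exact: cvg_id.
  by apply: continuous_comp; [exact: IH|exact: cT].
have : \forall z \near y, forall j : 'I_n,
    mdist (iter j T x) (iter j T z) < e.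
  apply: filter_forall => j.
  have /(bowen_dist_ltP _ _ _ e0)/(_ j (ltn_ord j)) h := xy.
  suff : nbhs (iter j T y) [set z | mdist (iter j T x) z < e] by move/citer.
  have r0 : 0 < e - mdist (iter j T x) (iter j T y) by rewrite subr_gt0.
  apply: filterS (nbhsx_ballx _ _ r0) => z; rewrite ballEmdist /= ltrBrDl.
  exact: le_lt_trans (metric_triangle _ _ _).
apply: filterS => z h.
by apply/bowen_dist_ltP => // j jn; exact: (h (Ordinal jn)).
Qed.

Lemma spanning_number_le1 (A : set X) n e : A !=set0 ->
  (1 <= spanning_number T A n e)%E.
Proof.
move=> [a Aa]; apply: le_ereal_inf_tmp => _ [E AE <-].
have [x xE _] := AE a Aa.
by rewrite lee_fin ler1n cardfs_gt0; apply/fset0Pn; exists x.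
Qed.


Lemma le_spanning_number (A : set X) n :
  {homo (fun e => spanning_number T A n e) : d e / d <= e >-> (e <= d)%E}.
Proof.
move=> d e de; apply: ereal_inf_le_tmp => _ [E AE <-]; exists E => //.
by move=> x /AE[z zE zx]; exists z => //; exact: lt_le_trans zx de.
Qed.

(** The limit in [e] is a supremum, so the strict bound holds at the given [e], hence at all large
    times; one positive time provides the finite cover. *)
Lemma top_entropy_lt_cover (A : set X) e c : A !=set0 -> 0 < e ->
  (top_entropy T A < c%:E)%E ->
  exists m (s : seq X), [/\ (0 < m)%N, (size s)%:R <= expR (c * m%:R) &
    A `<=` \bigcup_(z in [set` s]) bowen_ball T m z e].
Proof.
move=> A0 e0; rewrite /top_entropy lim_at_right0; last first.
  move=> d d' dd'; apply: le_limn_esup; apply: nearW => n.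
  apply: lee_wpmul2l; first by rewrite lee_fin invr_ge0.
  have sp r : spanning_number T A n r \in `[0, +oo]%E.
    by rewrite in_itv /= leey andbT (le_trans _ (spanning_number_le1 _ _ _)).
  by rewrite lee_lne//; exact: le_spanning_number.
move=> hc.
set f := (fun e => limn_esup _) in hc.
have {hc} : (f e < c%:E)%E.
  by apply: le_lt_trans hc; apply: ereal_sup_ubound; exists e.
move/limn_esup_lt_near => h.
have /filter_ex[m [/= mc m0]] : \oo
    ([set n | ((n%:R^-1)%:E * lne (spanning_number T A n e) < c%:E)%E] `&`
     [set n | (0 < n)%N]).
  by apply: filterI => //; exact: nbhs_infty_gt.
have m0R : 0 < m%:R :> R by rewrite ltr0n.
have : (spanning_number T A m e < (expR (c * m%:R))%:E)%E.
  (* The lower bound 1 rules out [-oo] and lets the logarithm be inverted; [mc] rules out [+oo]. *)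
  move: mc; have := spanning_number_le1 m e A0.
  case: (spanning_number T A m e) => [r| |] //; last first.
    by rewrite /= mulry gtr0_sg ?invr_gt0// mul1e.
  rewrite lee_fin => r1; have r0 : 0 < r by exact: lt_le_trans r1.
  rewrite lne_EFin// -EFinM !lte_fin mulrC ltr_pdivrMr// => h1.
  by rewrite -(lnK r0) ltr_expR.
move=> /ereal_inf_lt[_ [E AE <-]]; rewrite lte_fin => Ec.
exists m, (enum_fset E); split=> //; exact: ltW.
Qed.

End bowen_metric.

(** * Uniform continuity of the factor map *)

Section factor.
Context {R : realType}.
Variables (X Y : metricType R) (T : X -> X) (S : Y -> Y) (pi : X -> Y).

(** In the near-covering form of compactness, it suffices to find for each [x] a radius valid at all
    points near [x]; halving [e] and the radius leaves room for the triangle inequality. *)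
Lemma compact_metric_unif_continuous (f : X -> Y) (e : R) :
  compact [set: X] -> continuous f -> 0 < e ->
  exists2 d, 0 < d & forall x x', mdist x x' < d -> mdist (f x) (f x') < e.
Proof.
move=> /compact_near_coveringP cX cf e0.
have e20 : 0 < e / 2 by rewrite divr_gt0.
pose P d x := forall x', mdist x x' < d -> mdist (f x) (f x') < e.
have : \forall d \near (0 : R)^'+, [set: X] `<=` P d.
  apply: cX => x _.
  have : nbhs x (f @^-1` ball (f x) (e / 2)).
    by apply: cf; exact: nbhsx_ballx.
  move=> /nbhs_ballP[r /= r0 rP].
  have r20 : 0 < r / 2 by rewrite divr_gt0.
  exists (ball x (r / 2), [set d | d < r / 2]) => /=.
    split; first exact: nbhsx_ballx.
    exact: nbhs_right_lt.
  move=> [z d] /= [xz dr] z' zz'.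
  have xz' : ball x r z'.
    rewrite [r]splitr; apply: ball_triangle xz _.
    by rewrite ballEmdist /=; exact: lt_trans dr.
  rewrite (splitr e).
  apply: le_lt_trans (metric_triangle _ (f x) _) _; apply: ltrD.
    have : ball (f x) (e / 2) (f z).
      by apply: rP; apply: le_ball xz; lra.
    by rewrite /= ballEmdist /= metric_sym.
  by have := rP _ xz'; rewrite /= ballEmdist.
move=> nP.
have /filter_ex[d [/= dP d0]] : (0 : R)^'+ ([set d | [set: X] `<=` P d] `&` [set d | 0 < d]).
  by apply: filterI => //; exact: nbhs_right_gt.
by exists d => // x x'; exact: dP.
Qed.

Hypotheses (cX : compact [set: X]) (cT : continuous T) (hpi : factor_map T S pi).

Lemma factor_iter j x : pi (iter j T x) = iter j S (pi x).
Proof.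
case: hpi => _ _ pT; elim: j => //= j <-; exact: (pT (iter j T x)).
Qed.

Lemma factor_bowen_dist e : 0 < e -> exists2 d, 0 < d &
  forall n x x', bowen_dist T n x x' < d -> bowen_dist S n (pi x) (pi x') < e.
Proof.
move=> e0; case: (hpi) => cpi _ _.
have [d d0 dP] := compact_metric_unif_continuous cX cpi e0.
exists d => // n x x' /(bowen_dist_ltP _ _ _ _ d0) xx'.
by apply/bowen_dist_ltP => // j jn; rewrite -!factor_iter; apply/dP/xx'.
Qed.

(** * Bowen's block argument for the fibers *)

Definition block_cover (c e d : R) (y : Y) m (s : seq X) : Prop :=
  [/\ (0 < m)%N, (size s)%:R <= expR (c * m%:R) &
    forall x, mdist y (pi x) < d -> exists2 z, z \in s & bowen_dist T m z x < e].

(** A cover of one fiber by open Bowen balls also covers the nearby fibers: the complement of their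
    union [U] is compact, so its image is closed, and this image misses [y], hence a whole ball
    around [y]. *)
Lemma local_block_cover c e y : 0 < e -> (fiber_entropy T pi < c%:E)%E ->
  exists d m s, 0 < d /\ block_cover c e d y m s.
Proof.
move=> e0 hc; case: (hpi) => cpi spi _.
have fib0 : pi @^-1` [set y] !=set0.
  by have [x _ xy] := spi y I; exists x.
have : (top_entropy T (pi @^-1` [set y]) < c%:E)%E.
  by apply: le_lt_trans hc; apply: ereal_sup_ubound; exists y.
move=> /(top_entropy_lt_cover fib0 e0)[m [s [m0 sc sy]]].
set U := \bigcup_(z in _) _ in sy.
have oU : open U by apply: bigcup_open => z _; exact: bowen_ball_open.
have clW : closed (pi @` (~` U)).
  apply: compact_closed; first exact: metric_hausdorff.
  apply: continuous_compact; first exact/continuous_subspaceT.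
  apply: subclosed_compact cX _ => //; exact: open_closedC.
have : nbhs y (~` (pi @` (~` U))).
  apply: open_nbhs_nbhs; split; first exact: closed_openC.
  by move=> [x Ux xy]; apply: Ux; exact: sy.
move=> /nbhs_ballP[d /= d0 dU].
exists d, m, s; split=> //; split=> // x xy.
have [z /= zs zx] : U x.
  apply: contrapT => Ux; apply: (dU (pi x)); first by rewrite ballEmdist.
  by exists x.
by exists z.
Qed.

Lemma uniform_block_cover c e : compact [set: Y] -> 0 < e ->
  (fiber_entropy T pi < c%:E)%E ->
  exists M d, 0 < d /\ forall y, exists m s, (m <= M)%N /\ block_cover c e d y m s.
Proof.
move=> /compact_near_coveringP cY e0 hc.
(* The single index [n] bounds the block lengths and gives the radius. *)
pose P n y := exists m s, (m <= n)%N /\ block_cover c e n.+1%:R^-1 y m s.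
have : \forall n \near \oo, [set: Y] `<=` P n.
  apply: cY => y _.
  have [d [m [s [d0 [m0 sc sd]]]]] := local_block_cover y e0 hc.
  have d20 : 0 < d / 2 by rewrite divr_gt0.
  exists (ball y (d / 2), [set n : nat | (m <= n)%N /\ n.+1%:R^-1 < d / 2]) => /=.
    split; first exact: nbhsx_ballx.
    apply: filterI; first exact: nbhs_infty_ge.
    exact: (near_infty_natSinv_lt (PosNum d20)).
  move=> [z n] /= [yz [mn nd]]; exists m, s; split=> //; split=> // x zx.
  apply: sd; rewrite [d]splitr; apply: le_lt_trans (metric_triangle _ z _) _.
  apply: ltrD; last exact: lt_trans nd.
  by rewrite ballEmdist in yz.
move=> /filter_ex[n nP]; exists n, n.+1%:R^-1; split; first by rewrite invr_gt0.
by move=> y; exact: nP.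
Qed.

(* [g] splits the tube of points lying over [B_n(y, d)] into at most [k] pieces
   of [d_n]-diameter less than [e], the piece of [x] being numbered [g x]. *)
Definition tube_code n e d y k (g : X -> nat) : Prop :=
  (forall x, bowen_dist S n y (pi x) < d -> (g x < k)%N) /\
  (forall x x', bowen_dist S n y (pi x) < d -> bowen_dist S n y (pi x') < d ->
     g x = g x' -> bowen_dist T n x x' < e).

Lemma tube_code_exists c e M d : 0 < e -> 0 < d ->
  (forall y, exists m s, (m <= M)%N /\ block_cover c e d y m s) ->
  forall n y, exists k g, k%:R <= expR (c * (n + M)%:R) /\ tube_code n (e + e) d y k g.
Proof.
move=> e0 d0 blk.
case: (hpi) => _ spi _.
have ee0 : 0 < e + e by exact: addr_gt0.
(* The fiber of [y] is non-empty, so its block has at least one center, whence [1 <= expR (c * m)]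
   with [m > 0]. *)
have c0 (y : Y) : 0 <= c.
  have [m [s [mM [m0 sc sP]]]] := blk y.
  have [x _ xy] := spi y I.
  have [|z zs _] := sP x; first by rewrite xy mdistxx.
  have : 1 <= expR (c * m%:R).
    by apply: le_trans sc; rewrite ler1n; case: (s) zs.
  by rewrite -[leLHS]expR0 ler_expR pmulr_lge0 ?ltr0n.
(* The error [M] may only be paid once, at the last block, so the induction
   needs the sharper bound without [M] for [n = 0]. *)
suff : forall n y, exists k g,
    k%:R <= expR (c * (if n is 0 then 0 else n + M)%N%:R) /\
    tube_code n (e + e) d y k g.
  move=> h n y; have [k [g [kc gP]]] := h n y; exists k, g; split=> //.
  apply: le_trans kc _; rewrite ler_expR ler_wpM2l ?(c0 y)// ler_nat.
  by case: n {gP}.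
elim/ltn_ind => n IH y.
case: n IH => [|n] IH.
  exists 1%N, (fun=> 0%N); rewrite mulr0 expR0; split=> //; split=> // x x' _ _ _.
  by rewrite /bowen_dist big_ord0.
have [m [s [mM [m0 sc sP]]]] := blk y.
have [|k [g [kc [gk gP]]]] := IH (n.+1 - m)%N _ (iter m S y); first by lia.
(* Mixed radix: [b x] numbers the first block of the orbit of [x] and [g] the
   remaining ones. *)
pose b x := find (fun z => bowen_dist T m z x < e) s.
have tail x : bowen_dist S n.+1 y (pi x) < d ->
    bowen_dist S (n.+1 - m) (iter m S y) (pi (iter m T x)) < d.
  move=> /(bowen_dist_ltP _ _ _ _ d0) h; apply/bowen_dist_ltP => // j jn.
  by rewrite factor_iter -!iterD; apply: h; lia.
have bs x : bowen_dist S n.+1 y (pi x) < d ->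
    has (fun z => bowen_dist T m z x < e) s.
  move=> /(bowen_dist_ltP _ _ _ _ d0)/(_ 0%N isT)/sP[z zs zx].
  by apply/hasP; exists z.
exists (size s * k)%N, (fun x => b x * k + g (iter m T x))%N; split.
  rewrite natrM.
  apply: le_trans (ler_pM _ _ sc kc) _ => //; rewrite -expRD ler_expR.
  rewrite -mulrDr ler_wpM2l ?(c0 y)// -natrD ler_nat.
  (* If the first block reaches the end, its length is paid for by [m <= M]; otherwise [m] and the
     remaining time add up to [n.+1]. *)
  by case nm: (n.+1 - m)%N => [|p] /=; lia.
split=> [x xd|x x' xd x'd gg].
  have := bs _ xd; rewrite has_find -/(b x) => bx.
  have := gk _ (tail _ xd) => gx.
  nia.
have gx := gk _ (tail _ xd); have gx' := gk _ (tail _ x'd).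
have k0 : (0 < k)%N by lia.
have bb : b x = b x'.
  by have := congr1 (divn^~ k) gg; rewrite !divnMDl// !divn_small// !addn0.
have {}gg : g (iter m T x) = g (iter m T x') by lia.
have := gP _ _ (tail _ xd) (tail _ x'd) gg.
move=> /(bowen_dist_ltP _ _ _ _ ee0) h2.
(* Both points are [e]-close to the same center of [s], which gives [e + e] at times below [m]; the
   induction hypothesis covers the later times. *)
have hx := nth_find x (bs _ xd); have := nth_find x (bs _ x'd).
rewrite /= -/(b x) -/(b x') -bb in hx *; move: hx.
rewrite bowen_distC => h1 h1'.
have /(bowen_dist_ltP _ _ _ _ ee0) {h1 h1'}h1 := bowen_dist_triangle e0 e0 h1 h1'.
apply/bowen_dist_ltP => // j jn.
have [jm|mj] := ltnP j m; first exact: h1.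
have := h2 (j - m)%N; rewrite -!iterD subnK//; apply; lia.
Qed.

Lemma uniform_tube_code c e : compact [set: Y] -> 0 < e ->
  (fiber_entropy T pi < c%:E)%E ->
  exists M d, 0 < d /\ forall n, exists k, k%:R <= expR (c * (n + M)%:R) /\
    forall y, exists g, tube_code n e d y k g.
Proof.
move=> cY e0 hc; have e20 : 0 < e / 2 by rewrite divr_gt0.
have [M [d [d0 blk]]] := uniform_block_cover cY e20 hc.
exists M, d; split=> // n.
(* The number of pieces may vary with [y], but it is an integer below the exponential, so the
   integer part bounds it for all [y] at once. *)
exists (Num.truncn (expR (c * (n + M)%:R))); split.
  by rewrite Num.Theory.truncn_le expR_ge0.
move=> y; have [k [g [kc [gk gP]]]] := tube_code_exists e20 d0 blk n y.
exists g; split; last by rewrite -splitr in gP.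
move=> x /gk /leq_trans; apply; rewrite truncn_ge_nat// expR_ge0.
Qed.

End factor.

(** * Scalings along the sequence [expR (- n)] *)

Section scaling_theory.
Context {R : realType}.
Variables (scl : R -> R -> R) (hscl : scaling scl).

Lemma scl_exp_gt0 a n : 0 <= a -> (0 < n)%N -> 0 < scl_exp scl a n.
Proof.
move=> a0 n0; case: hscl => pos _ _ _; apply: pos => //.
by rewrite expR_gt0 /= expR_lt1 oppr_lt0 ltr0n.
Qed.

Lemma near_expRN (P : R -> Prop) :
  (\forall e \near 0^'+, P e) -> \forall n \near \oo, P (expR (- n%:R)).
Proof.
move=> [r /= r0 rP].
have : \forall n \near \oo, expR (- n%:R : R) < r.
  have := cvg_comp _ _ (@cvgr_idn R) (@cvgr_expR R).
  move/cvgrPdist_lt/(_ r r0); apply: filterS => n /=.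
  by rewrite sub0r normrN ger0_norm ?expR_ge0.
apply: filterS => n nr; apply: rP; last exact: expR_gt0.
by rewrite /= sub0r normrN ger0_norm ?expR_ge0.
Qed.

(** For some [l > 1], [scl a] is negligible against the power [l] of [scl b]; since [scl b] tends to
    0, it is eventually below 1 and dominates that power. *)
Lemma scl_exp_little a b eta : 0 < b -> b < a -> 0 < eta ->
  \forall n \near \oo, scl_exp scl a n <= eta * scl_exp scl b n.
Proof.
move=> b0 ba eta0; case: (hscl) => pos _ little lim0.
near (1 : R)^'+ => l.
have l1 : 1 < l by near: l; exact: nbhs_right_gt.
have lo : \forall e \near (0 : R)^'+, `|scl a e| <= eta * `|scl b e `^ l|.
  by near: l; apply: filterS (little a b b0 ba) => l [_ /eqoP]; exact.
have b1 : \forall e \near (0:R)^'+, scl b e < 1.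
  have /cvgrPdist_lt/(_ 1 ltr01) := lim0 _ b0.
  by apply: filterS => e; rewrite sub0r normrN => /(le_lt_trans (ler_norm _)).
apply: (near_expRN (P := fun e => scl a e <= eta * scl b e)); near=> e.
have e0 : 0 < e by near: e; exact: nbhs_right_gt.
have e1 : e < 1 by near: e; exact: nbhs_right_lt.
have scl_b : 0 < scl b e by apply: pos; rewrite ?ltW// e0.
apply: le_trans (ler_norm _) _.
apply: (@le_trans _ _ (eta * `|scl b e `^ l|)); first by near: e.
rewrite ler_pM2l// ger0_norm ?powR_ge0//.
rewrite -[leRHS]powRr1; last exact: ltW.
apply: ger_powR; last exact: ltW.
by rewrite scl_b ltW//; near: e.
Unshelve. all: by end_near. Qed.

Lemma scl_exp_transfer a c g : 0 <= a -> 0 < g ->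
  (limn_esup (fun n => (expR (c * n%:R) * (scl_exp scl g n / scl_exp scl a n))%:E)
     < +oo)%E ->
  exists2 D, 0 < D & \forall n \near \oo,
    expR (c * n%:R) * scl_exp scl g n <= D * scl_exp scl a n.
Proof.
move=> a0 g0; set L := limn_esup _ => Ly.
(* Formally [L] may be [-oo], and then any real serves; the maximum with 1 below makes the constant
   positive. *)
have [D LD] : exists D : R, (L < D%:E)%E.
  case: L Ly => [r| |] // _; last by exists 0; rewrite ltNyr.
  by exists (r + 1); rewrite lte_fin ltrDl.
exists (Num.max D 1); first by rewrite lt_max ltr01 orbT.
have := limn_esup_lt_near LD; apply: filterS2 (nbhs_infty_gt 0%N) => n n0.
have sa := scl_exp_gt0 a0 n0.
rewrite lte_fin mulrA ltr_pdivrMr// => /ltW /le_trans; apply.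
by rewrite ler_pM2r// le_max lexx.
Qed.

End scaling_theory.

(** * Separated numbers and the upper capacity *)

Section capacity.
Context {R : realType}.
Variables (scl : R -> R -> R) (hscl : scaling scl).

Lemma separated_number_ge0 (X : metricType R) (T : X -> X) K n e :
  (0 <= separated_number T K n e)%E.
Proof.
apply: ereal_sup_ubound; exists fset0; last by rewrite cardfs0.
by split.
Qed.

Lemma le_separated_number (X : metricType R) (T : X -> X) K n :
  {homo (fun e => separated_number T K n e) : d e / d <= e >-> (e <= d)%E}.
Proof.
move=> d e de; apply: ereal_sup_le => _ [F [FK Fe] <-]; exists F => //.
by split=> // x y xF yF xy; apply: le_trans de (Fe x y xF yF xy).
Qed.

(** Vanishing becomes an eventual estimate at each fixed scale, free of limits; both capacity
    inequalities are proved in this form. *)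
Lemma upper_capacity_eq0P (X : metricType R) (T : X -> X) K a : 0 <= a ->
  upper_capacity scl a T K = 0%E <->
  forall e eta, 0 < e -> 0 < eta -> \forall n \near \oo,
    (separated_number T K n e * (scl_exp scl a n)%:E <= eta%:E)%E.
Proof.
move=> a0; rewrite /upper_capacity.
(* At [n = 0] the argument [expR 0 = 1] lies outside the domain of the scaling, so the sign is known
   only for [n > 0]. *)
have scl0 : \forall n \near \oo, (0 <= (scl_exp scl a n)%:E)%E.
  apply: filterS (nbhs_infty_gt 0%N) => n n0.
  by rewrite lee_fin ltW// (scl_exp_gt0 hscl).
rewrite lim_at_right0; last first.
  move=> d e de; apply: le_limn_esup; apply: filterS scl0 => n s0.
  by apply: lee_wpmul2r => //; exact: le_separated_number.
split=> [lim0 e eta e0 eta0|h].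
  pose u n := (separated_number T K n e * (scl_exp scl a n)%:E)%E.
  suff : (limn_esup u < eta%:E)%E.
    by move/limn_esup_lt_near; apply: filterS => n /ltW.
  apply: le_lt_trans (_ : (0 < eta%:E)%E); last by rewrite lte_fin.
  by rewrite -lim0; apply: ereal_sup_ubound; exists e.
apply/eqP; rewrite eq_le; apply/andP; split.
  apply: ge_ereal_sup => _ [e /= e0 <-]; apply/lee_addgt0Pr => eta eta0.
  by rewrite add0e; apply: near_limn_esup_le; exact: h.
apply: le_ereal_sup_tmp; eexists; first by exists 1 => //=; exact: ltr01.
apply: near_limn_esup_ge; apply: filterS scl0 => n s0.
by rewrite mule_ge0// separated_number_ge0.
Qed.

Section factor.
Variables (X Y : metricType R) (T : X -> X) (S : Y -> Y) (pi : X -> Y).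
Hypotheses (hT : dynamical_system T) (hS : dynamical_system S).
Hypothesis (hpi : factor_map T S pi).

(** Lift each point of a separated set to a preimage in [K]: two lifts closer than [d] would have
    images closer than [e]. *)
Lemma le_separated_number_factor K e : 0 < e -> exists2 d, 0 < d &
  forall n, (separated_number S (pi @` K) n e <= separated_number T K n d)%E.
Proof.
move=> e0; have [d d0 dP] := factor_bowen_dist hT.1 hpi e0.
exists d => // n; apply: ge_ereal_sup => _ [F [FK Fe] <-].
have /choice[g gP] : forall y, exists x, y \in F -> K x /\ pi x = y.
  move=> y; have [yF|_] := boolP (y \in F); last first.
    case: hpi => _ /(_ y Logic.I)[x _ _] _; by exists x.
  by have [x Kx xy] := FK y yF; exists x.
apply: ereal_sup_ubound; exists [fset g y | y in F]%fset; last first.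
  rewrite card_in_imfset// => y y' yF y'F gyy.
  by rewrite -(gP y yF).2 gyy (gP y' y'F).2.
split=> [x /= /imfsetP[y /= yF ->]|_ _ /imfsetP[y /= yF ->] /imfsetP[y' /= y'F ->] yy].
  exact: (gP y yF).1.
rewrite leNgt; apply/negP => /dP; rewrite (gP y yF).2 (gP y' y'F).2 ltNge.
by rewrite Fe//; apply: contra_neq yy => ->.
Qed.

(** Let [G] be a maximal [d]-separated part of [pi F]. Send [x] in [F] to a point of [G] near
    [pi x], together with the code of [x] in the tube of that point. Equal pairs force distance less
    than [e], so the map is injective on the [e]-separated [F], and [F] has at most [size G * k]
    points. *)
Lemma separated_number_le_factor K c e : 0 < e -> (fiber_entropy T pi < c%:E)%E ->
  exists M d, 0 < d /\ forall n, (separated_number T K n e <=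
    separated_number S (pi @` K) n d * (expR (c * (n + M)%:R))%:E)%E.
Proof.
move=> e0 hc; have [M [d [d0 hM]]] := uniform_tube_code hT.1 hT.2 hpi hS.1 e0 hc.
exists M, d; split=> // n; have [k [kc /choice[g gP]]] := hM n.
apply: ge_ereal_sup => _ [F [FK Fe] <-].
pose close (x x' : Y) := bowen_dist S n x x' < d.
have closexx : reflexive close by move=> y; rewrite /close bowen_distxx.
have closeC : symmetric close by move=> y y'; rewrite /close bowen_distC.
have [G [uG GF Gsep Gcov]] := maximal_separated closexx closeC [seq pi x | x <- F].
have /choice[r rP] : forall x, exists y, x \in F -> y \in G /\ close y (pi x).
  move=> x; have [xF|_] := boolP (x \in F); last by exists (pi x).
  by have [y yG yx] := Gcov _ (map_f pi xF); exists y.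
have FG : (#|` F| <= size G * k)%N.
  pose h x := (r x, g (r x) x).
  have tube x : x \in F -> bowen_dist S n (r x) (pi x) < d by case/rP.
  have uh : uniq [seq h x | x <- F].
    rewrite map_inj_in_uniq ?fset_uniq// => x x' xF x'F [rr].
    rewrite -rr => gg; apply/eqP/negPn/negP => /(Fe _ _ xF x'F).
    by rewrite leNgt (gP (r x)).2//; [exact: tube|rewrite rr; exact: tube].
  have -> : (size G * k = size [seq (y, j) | y <- G, j <- iota 0 k])%N.
    by rewrite size_allpairs size_iota.
  rewrite -(size_map h); apply: uniq_leq_size => // _ /mapP[x xF ->].
  apply/allpairsP; exists (h x); split=> //=; first exact: (rP x xF).1.
  by rewrite mem_iota /= (gP (r x)).1//; exact: tube.
apply: (@le_trans _ _ ((size G)%:R%:E * (expR (c * (n + M)%:R))%:E)%E).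
  rewrite -EFinM lee_fin (@le_trans _ _ (size G * k)%:R) ?ler_nat//.
  by rewrite natrM ler_wpM2l.
apply: lee_wpmul2r; first by rewrite lee_fin expR_ge0.
apply: ereal_sup_ubound; exists [fset y in G]%fset; last by rewrite card_fseq undup_id.
split=> [y /=|y y']; rewrite !inE.
  by move=> /GF/mapP[x xF ->]; exists x => //; exact: FK.
by move=> yG y'G yy; rewrite leNgt; exact: Gsep.
Qed.

End factor.
End capacity.

(** * Bowen premeasures and measures *)

Section bowen_measure_theory.
Context {R : realType}.
Variables (scl : R -> R -> R) (hscl : scaling scl).

Section premeasure.
Variables (X : metricType R) (T : X -> X).
Implicit Types E : set X.

Lemma le_bowen_premeasure a E N :
  {homo (fun e => bowen_premeasure scl a T E e N) : d e / d <= e >-> (e <= d)%E}.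
Proof.
move=> d e de; apply: ereal_inf_le_tmp => _ [I [x [n [In EI ->]]]].
exists I, x, n; split=> // z /EI[i Ii zi]; exists i => //.
exact: lt_le_trans zi de.
Qed.

Lemma bowen_premeasure_nondecreasing a E e :
  nondecreasing_seq (bowen_premeasure scl a T E e).
Proof.
move=> N N' NN'; apply: ereal_inf_le_tmp => _ [I [x [n [In EI ->]]]].
exists I, x, n; split=> // i /In[n0 N'n]; split=> //.
exact: leq_trans N'n.
Qed.

Lemma limn_bowen_premeasure a E e : limn (bowen_premeasure scl a T E e) =
  ereal_sup (range (bowen_premeasure scl a T E e)).
Proof.
by apply: cvg_lim => //; apply: ereal_nondecreasing_cvgn; exact: bowen_premeasure_nondecreasing.
Qed.

Lemma bowen_measureE a E : bowen_measure scl a T E =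
  ereal_sup ((fun e => limn (bowen_premeasure scl a T E e)) @` [set e | 0 < e]).
Proof.
rewrite /bowen_measure lim_at_right0// => d e de.
rewrite !limn_bowen_premeasure; apply: ge_ereal_sup => _ [N _ <-].
apply: le_ereal_sup_tmp; eexists; first by exists N.
exact: le_bowen_premeasure.
Qed.

Lemma bowen_premeasure_le_measure a E e N : 0 < e ->
  (bowen_premeasure scl a T E e N <= bowen_measure scl a T E)%E.
Proof.
move=> e0; rewrite bowen_measureE.
apply: le_ereal_sup_tmp; eexists; first by exists e.
by rewrite limn_bowen_premeasure; apply: ereal_sup_ubound; exists N.
Qed.

Lemma bowen_measure_le a E M :
  (forall e N, 0 < e -> (bowen_premeasure scl a T E e N <= M)%E) ->
  (bowen_measure scl a T E <= M)%E.
Proof.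
move=> h; rewrite bowen_measureE; apply: ge_ereal_sup => _ [e /= e0 <-].
by rewrite limn_bowen_premeasure; apply: ge_ereal_sup => _ [N _ <-]; exact: h.
Qed.

Lemma bowen_premeasure_le_esum (U : countType) (P : set U) (x : U -> X)
    (n : U -> nat) a E e N : E !=set0 ->
  (forall u, P u -> (0 < n u)%N /\ (N <= n u)%N) ->
  E `<=` \bigcup_(u in P) bowen_ball T (n u) (x u) e ->
  (bowen_premeasure scl a T E e N <= \esum_(u in P) (scl_exp scl a (n u))%:E)%E.
Proof.
move=> [x0 Ex0] Pn EP; apply: ereal_inf_lbound.
exists (choice.pickle @` P), (fun i => oapp x x0 (choice.unpickle i)),
  (fun i => oapp n 0%N (choice.unpickle i)); split.
- by move=> _ [u Pu <-]; rewrite choice.pickleK /=; exact: Pn.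
- move=> z /EP[u Pu uz]; exists (choice.pickle u); first by exists u.
  by rewrite choice.pickleK.
- rewrite esum_image; last by move=> u v _ _; exact: (pcan_inj choice.pickleK).
  by apply: eq_esum => u _; rewrite choice.pickleK.
Qed.

End premeasure.

Section factor.
Variables (X Y : metricType R) (T : X -> X) (S : Y -> Y) (pi : X -> Y).
Hypotheses (hT : dynamical_system T) (hS : dynamical_system S).
Hypothesis (hpi : factor_map T S pi).

(** Pushing the centers of a cover forward keeps its times, hence its sum. *)
Lemma le_bowen_measure_factor a E :
  (bowen_measure scl a S (pi @` E) <= bowen_measure scl a T E)%E.
Proof.
apply: bowen_measure_le => e N e0.
have [d d0 dP] := factor_bowen_dist hT.1 hpi e0.
apply: le_trans (bowen_premeasure_le_measure T a E N d0).
apply: ereal_inf_le_tmp => _ [I [x [n [In EI ->]]]].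
exists I, (pi \o x), n; split=> // _ [z /EI[i Ii zi] <-]; exists i => //.
exact: dP.
Qed.

(** Over each ball of a cover of [pi E], the tube splits into at most [expR (c * (n + M))] pieces,
    each inside one Bowen ball of the same time. The assumed inequality trades this count for the
    change from [scl a] to [scl b]. *)
Lemma bowen_premeasure_le_factor a b c e E : 0 <= a -> E !=set0 ->
  0 < e -> (fiber_entropy T pi < c%:E)%E ->
  exists M d, 0 < d /\ forall D N, 0 < D ->
    (forall n, (N <= n)%N ->
       expR (c * (n + M)%:R) * scl_exp scl a n <= D * scl_exp scl b n) ->
    (bowen_premeasure scl a T E e N <=
       D%:E * bowen_premeasure scl b S (pi @` E) d N)%E.
Proof.
move=> a0 E0 e0 hc.
have [M [d [d0 hM]]] := uniform_tube_code hT.1 hT.2 hpi hS.1 e0 hc.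
exists M, d; split=> // D N D0 hN.
(* Dividing by [D] leaves the infimum alone on the right, so a single cover downstairs can be fixed
   before multiplying back. *)
rewrite muleC -lee_pdivrMr//.
apply: le_ereal_inf_tmp => _ [I [y [n [In EI ->]]]].
rewrite lee_pdivrMr// muleC.
have /choice[k hk] := hM.
have /choice[g gP] : forall p : nat * Y, exists g, tube_code T S pi p.1 e d p.2 (k p.1) g.
  by move=> p; exact: (hk p.1).2.
(* The center for the pair [(i, j)] is any point of piece [j] over ball [i]; for an empty piece the
   requirement is vacuous and [x0] serves. *)
have /choice[z zP] : forall p : nat * nat, exists z, forall x,
    bowen_dist S (n p.1) (y p.1) (pi x) < d -> g (n p.1, y p.1) x = p.2 ->
    bowen_dist T (n p.1) z x < e.
  move=> [i j] /=.
  have [[z [zi zj]]|nz] := pselect (exists z,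
    bowen_dist S (n i) (y i) (pi z) < d /\ g (n i, y i) z = j).
    by exists z => x xi xj; apply: (gP (n i, y i)).2 => //; rewrite zj.
  case: E0 => x0 _; exists x0 => x xi xj.
  by exfalso; apply: nz; exists x.
pose J i := `I_(k (n i)).
apply: (@le_trans _ _ (\esum_(p in I `*`` J) (scl_exp scl a (n p.1))%:E)).
  apply: (@bowen_premeasure_le_esum _ _ _ _ z) => //.
    by move=> [i j] [/= Ii _]; exact: In.
  move=> x Ex.
  have [i Ii xi] : (\bigcup_(i in I) bowen_ball S (n i) (y i) d) (pi x).
    by apply: EI; exists x.
  exists (i, g (n i, y i) x) => /=.
    by split=> //=; exact: (gP (n i, y i)).1.
  exact: (zP (i, g (n i, y i) x) x xi erefl).
have scl0 i : I i -> 0 <= scl_exp scl a (n i).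
  by move=> /In[n0 _]; rewrite ltW// (scl_exp_gt0 hscl).
rewrite -(@esum_esum _ _ _ _ _ (fun i j => (scl_exp scl a (n i))%:E)); last first.
  by move=> i j /scl0 si _; rewrite lee_fin.
apply: (@le_trans _ _ (\esum_(i in I) (D * scl_exp scl b (n i))%:E)).
  apply: le_esum => i Ii; rewrite esum_fset; last 2 first.
  - exact: finite_II.
  - by move=> j _; rewrite lee_fin scl0.
  rewrite -fsbig_ord sumEFin lee_fin sumr_const card_ord -mulr_natl.
  apply: le_trans (hN _ (In _ Ii).2).
  by rewrite ler_wpM2r ?scl0// (hk (n i)).1.
(* The infinite sum is a supremum of finite sums, and [D] is factored out of each of these. *)
apply: ge_ereal_sup => _ [A [finA AI] <-].
rewrite fsumEFin// -mulr_fsumr EFinM lee_wpmul2l ?lee_fin ?(ltW D0)//.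
by rewrite -fsumEFin//; apply: ereal_sup_ubound; exists A.
Qed.

End factor.
End bowen_measure_theory.

(** * The entropy inequalities *)

Section inequalities.
Context {R : realType}.
Variables (scl : R -> R -> R) (hscl : scaling scl).
Variables (X Y : metricType R) (T : X -> X) (S : Y -> Y) (pi : X -> Y).
Hypotheses (hT : dynamical_system T) (hS : dynamical_system S).
Hypothesis (hpi : factor_map T S pi).
Local Open Scope ereal_scope.

Lemma upper_capacity_entropy_factor_le K :
  upper_capacity_entropy scl S (pi @` K) <= upper_capacity_entropy scl T K.
Proof.
apply: ereal_inf_le_tmp => _ [a [a0 /upper_capacity_eq0P-/(_ hscl (ltW a0)) LT] <-].
exists a => //; split=> //; apply/(upper_capacity_eq0P hscl) => [|e eta e0 eta0].
  exact: ltW.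
have [d d0 dP] := le_separated_number_factor hT hpi K e0.
apply: filterS2 (LT d eta d0 eta0) (nbhs_infty_gt 0%N) => n + n0.
apply: le_trans; apply: lee_wpmul2r => //.
by rewrite lee_fin ltW// (scl_exp_gt0 hscl)// ltW.
Qed.

Lemma upper_capacity_entropy_ge0 (Z : metricType R) (U : Z -> Z) K :
  0 <= upper_capacity_entropy scl U K.
Proof. by apply: le_ereal_inf_tmp => _ [a [a0 _] <-]; rewrite lee_fin ltW. Qed.

(** The infimum yields some [b < a] with vanishing capacity, and [scl a] is eventually below
    [scl b]. *)
Lemma upper_capacity_eq0_gt (Z : metricType R) (U : Z -> Z) K a :
  upper_capacity_entropy scl U K < a%:E -> upper_capacity scl a U K = 0.
Proof.
move=> /ereal_inf_lt[_ [b [b0 Lb] <-]]; rewrite lte_fin => ba.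
have a0 : (0 <= a)%R by rewrite ltW// (lt_trans b0).
apply/(upper_capacity_eq0P hscl) => // e eta e0 eta0.
move/(upper_capacity_eq0P hscl _ _ (ltW b0)) : Lb => /(_ e eta e0 eta0).
apply: filterS2 (scl_exp_little hscl b0 ba ltr01) => n.
rewrite mul1r => sab; apply: le_trans; apply: lee_wpmul2l.
  exact: separated_number_ge0.
by rewrite lee_fin.
Qed.

Lemma upper_capacity_entropy_le_transfer K :
  upper_capacity_entropy scl T K <=
    transfer scl (upper_capacity_entropy scl S (pi @` K)) (fiber_entropy T pi).
Proof.
have := upper_capacity_entropy_ge0 S (pi @` K).
have := @upper_capacity_eq0_gt _ S (pi @` K).
case: (upper_capacity_entropy scl S _) => [u| |]; rewrite /transfer ?leey// => Lu.
rewrite lee_fin => u0.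
case Ea : (fiber_entropy T pi) => [a| |]; rewrite ?leey//.
apply: le_ereal_inf_tmp => _ [g [g0 [al [tau [ual tau0 hlim]]]] <-].
have al0 : (0 <= al)%R by rewrite ltW// (le_lt_trans u0).
have [D D0 hD] := scl_exp_transfer hscl al0 g0 hlim.
(* The slack [tau] from the transfer function supplies the strict margin that the block argument
   requires. *)
have hc : fiber_entropy T pi < (a + tau)%:E by rewrite Ea lte_fin ltrDl.
apply: ereal_inf_lbound; exists g => //; split=> //.
apply/(upper_capacity_eq0P hscl) => [|e eta e0 eta0]; first exact: ltW.
have [M [d [d0 hMd]]] := separated_number_le_factor hT hS hpi K e0 hc.
(* [B] collects the two constant losses, from the overshoot [M] and from the scaling comparison; the
   estimate downstairs is then used with [eta / B]. *)
set B := (expR ((a + tau) * M%:R) * D)%R.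
have B0 : (0 < B)%R by rewrite mulr_gt0// expR_gt0.
have := (upper_capacity_eq0P hscl S (pi @` K) al0).1 (Lu al _).
rewrite lte_fin => /(_ ual d (eta / B)%R d0 (divr_gt0 eta0 B0)).
apply: filterS3 hD (nbhs_infty_gt 0%N) => n hDn n0 hn.
have sg : (0 <= scl_exp scl g n)%R by rewrite ltW// (scl_exp_gt0 hscl)// ltW.
apply: (@le_trans _ _ (separated_number S (pi @` K) n d * (B * scl_exp scl al n)%:E)).
  apply: le_trans (lee_wpmul2r _ (hMd n)) _; first by rewrite lee_fin.
  rewrite -muleA; apply: lee_wpmul2l; first exact: separated_number_ge0.
  rewrite -EFinM lee_fin natrD mulrDr expRD mulrAC mulrC /B -mulrA.
  by rewrite ler_wpM2l// expR_ge0.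
rewrite EFinM muleCA; apply: le_trans (lee_wpmul2l _ hn) _.
  by rewrite lee_fin ltW.
by rewrite -EFinM lee_fin mulrC divfK ?gt_eqF.
Qed.

Lemma bowen_entropy_factor_le E :
  bowen_entropy scl S (pi @` E) <= bowen_entropy scl T E.
Proof.
apply: ereal_sup_le => x [->|[a [a0 Sa] <-]]; first by left.
right; exists a => //; split=> //; apply/eqP; rewrite -leye_eq -Sa.
exact: le_bowen_measure_factor.
Qed.

Lemma bowen_entropy_le_transfer E : E !=set0 ->
  bowen_entropy scl T E <=
    transfer scl (bowen_entropy scl S (pi @` E)) (fiber_entropy T pi).
Proof.
move=> E0.
have : 0 <= bowen_entropy scl S (pi @` E) by apply: ereal_sup_ubound; left.
have : forall b : R, (0 < b)%R -> bowen_entropy scl S (pi @` E) < b%:E ->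
    bowen_measure scl b S (pi @` E) < +oo.
  move=> b b0; rewrite ltNge; apply: contraNT; rewrite -leNgt leye_eq => /eqP Sb.
  by apply: ereal_sup_ubound; right; exists b.
case: (bowen_entropy scl S _) => [u| |]; rewrite /transfer ?leey// => Mu.
rewrite lee_fin => u0.
case Ea : (fiber_entropy T pi) => [a| |]; rewrite ?leey//.
apply: le_ereal_inf_tmp => _ [g [g0 [al [tau [ual tau0 hlim]]]] <-].
have al0 : (0 < al)%R by exact: le_lt_trans ual.
have [D D0 hD] := scl_exp_transfer hscl (ltW al0) g0 hlim.
have hc : fiber_entropy T pi < (a + tau)%:E by rewrite Ea lte_fin ltrDl.
apply: ge_ereal_sup => _ [->|[a' [a'0 Ta'] <-]]; first by rewrite lee_fin ltW.
(* Downstairs the measure at [al] is only known to be finite. The gap [g < a'] provides an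
   arbitrarily small factor, which bounds the measure upstairs at [a'] by 1, against [Ta']. *)
rewrite lee_fin leNgt; apply/negP => ga'.
have {Mu}Mal : bowen_measure scl al S (pi @` E) < +oo by rewrite Mu// lte_fin.
have [B B0 MB] : exists2 B : R, (0 < B)%R & bowen_measure scl al S (pi @` E) <= B%:E.
  case: (bowen_measure _ _ _ _) Mal => [r| |] // _; last by exists 1%R; rewrite ?ltr01 ?leNye.
  exists (Num.max r 1%R); first by rewrite lt_max ltr01 orbT.
  by rewrite lee_fin le_max lexx.
suff : bowen_measure scl a' T E <= 1 by rewrite Ta' leye_eq.
apply: bowen_measure_le => e N e0.
have [M [d [d0 hMd]]] := bowen_premeasure_le_factor hscl hT hS hpi al (ltW a'0) E0 e0 hc.
set C := expR ((a + tau) * M%:R).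
have C0 : (0 < C)%R by exact: expR_gt0.
(* This factor cancels [C] and [D] and leaves [B^-1], to be multiplied by the bound [B] on the
   measure downstairs. *)
have eta0 : (0 < (C * D * B)^-1)%R by rewrite invr_gt0 !mulr_gt0.
have [N0 _ hN0] : \forall n \near \oo,
    (expR ((a + tau) * (n + M)%:R) * scl_exp scl a' n <= B^-1 * scl_exp scl al n)%R.
  apply: filterS2 hD (scl_exp_little hscl g0 ga' eta0) => n hDn hn.
  rewrite natrD mulrDr expRD -/C.
  apply: le_trans (ler_wpM2l _ hn) _.
    by rewrite mulr_ge0// expR_ge0.
  rewrite (_ : (_ * _ * _ = ((C * D * B)^-1 * C) *
    (expR ((a + tau) * n%:R) * scl_exp scl g n))%R); last by ring.
  apply: le_trans (ler_wpM2l _ hDn) _.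
    by rewrite mulr_ge0// ltW.
  rewrite le_eqVlt; apply/orP; left; apply/eqP; field.
  by rewrite !gt_eqF.
(* Raising [N] only increases the premeasure, so all times may be taken beyond the threshold
   [N0]. *)
apply: le_trans (bowen_premeasure_nondecreasing _ _ _ _ _ (leq_maxl N N0)) _.
apply: le_trans (hMd B^-1%R _ _ _) _.
- by rewrite invr_gt0.
- by move=> n; rewrite geq_max => /andP[_]; exact: hN0.
rewrite muleC lee_pdivrMr// mul1e; apply: le_trans MB.
exact: bowen_premeasure_le_measure.
Qed.

End inequalities.

Local Open Scope ereal_scope.

Theorem theorem1p2 (R : realType) (X Y : metricType R)
    (T : X -> X) (S : Y -> Y) (pi : X -> Y) (scl : R -> R -> R)
    (hT : dynamical_system T) (hS : dynamical_system S)
    (hpi : factor_map T S pi) (hscl : scaling scl) :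
  (forall K : set X, K !=set0 -> compact K ->
     upper_capacity_entropy scl S (pi @` K) <= upper_capacity_entropy scl T K /\
     upper_capacity_entropy scl T K <=
       transfer scl (upper_capacity_entropy scl S (pi @` K))
                    (fiber_entropy T pi)) /\
  (forall E : set X, E !=set0 ->
     bowen_entropy scl S (pi @` E) <= bowen_entropy scl T E /\
     bowen_entropy scl T E <=
       transfer scl (bowen_entropy scl S (pi @` E)) (fiber_entropy T pi)).
Proof.
split=> [K _ _|E E0]; split.
- exact: upper_capacity_entropy_factor_le.
- exact: upper_capacity_entropy_le_transfer.
- exact: bowen_entropy_factor_le.
- exact: bowen_entropy_le_transfer.
Qed.
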